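(* Let $G$ be a direct limit of Polish groups and let $K\subset G$ be a compact subgroup. If a $*$-representation $\tau$ of the algebra $\mathcal{M}(G/\!\!/K)$ in a Hilbert space $V$ can be represented (up to equivalence) both as $\mathcal{R}es_{G/\!\!/K}(\rho)$ and as $\mathcal{R}es_{G/\!\!/K}(\rho')$, where $\rho,\rho'$ are unitary representations of $G$ in each of which the subspace of $K$-fixed vectors is cyclic, then $\rho\simeq\rho'$ (unitary equivalence).
   Context: Hilbert spaces are separable; unitary representations are (strongly) continuous. A Polish group is a topological group whose topology is Polish. A direct limit of Polish groups is $G=\bigcup_j G_j$ for a sequence $G_1\subset G_2\subset\cdots$ of Polish groups (each a topological subgroup of the next), where $U\subset G$ is open iff all $U\cap G_j$ are open in $G_j$. Every compact subset of $G$ lies in some $G_j$. $\mathcal{M}(G)$ is the algebra of finite compactly supported complex-valued Borel measures on $G$, with convolution as multiplication ($\mu_1*\mu_2$ is the pushforward of $\mu_1\times\mu_2$ under $(g_1,g_2)\mapsto g_1g_2$) and involution $\mu\mapsto\mu^\star$, the pushforward of the complex conjugate measure $\overline\mu$ under $g\mapsto g^{-1}$. $\mathcal{M}(G/\!\!/K)\subset\mathcal{M}(G)$ is the $*$-subalgebra of measures invariant under left and right shifts by elements of $K$. For a unitary representation $\rho$ of $G$ in $H$ put $\rho(\mu)=\int_G\rho(g)\,d\mu(g)$ for $\mu\in\mathcal{M}(G)$. Let $H^K$ be the subspace of $K$-fixed vectors; it is called cyclic if the linear combinations of vectors $\rho(g)\eta$, $g\in G$, $\eta\in H^K$, are dense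 in $H$. For $\nu\in\mathcal{M}(G/\!\!/K)$ the operator $\rho(\nu)$ preserves $H^K$ and vanishes on $(H^K)^\perp$; its restriction to $H^K$ is denoted $\widetilde\rho(\nu)$. Then $\mathcal{R}es_{G/\!\!/K}(\rho):=\widetilde\rho$ is a $*$-representation of $\mathcal{M}(G/\!\!/K)$ in $H^K$. *)

(* Defs.v *)
From HB Require Import structures.
From mathcomp Require Import all_boot all_order all_algebra.
From mathcomp Require Import sesquilinear.
From mathcomp Require Import all_classical all_reals all_analysis.
From mathcomp Require Import complex.

Set Implicit Arguments.
Unset Strict Implicit.
Unset Printing Implicit Defensive.

Import Order.TTheory GRing.Theory Num.Theory.
Import numFieldNormedType.Exports.

Local Open Scope classical_set_scope.
Local Open Scope ring_scope.
Local Open Scope complex_scope.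

(* No compatibility is required here: multiplication on a direct limit of
   Polish groups need not be jointly continuous.  The [Pointed] component is
   there only because measurable types have to be pointed. *)
#[short(type="preTopologicalGroupType")]
HB.structure Definition PreTopologicalGroup :=
  {G of PointedTopological G & Group G}.

HB.mixin Record PreTopologicalGroup_isTopologicalGroup G
    & PreTopologicalGroup G := {
  mulg_continuous : continuous (fun p : G * G => (p.1 * p.2)%g) ;
  invg_continuous : continuous (fun x : G => (x^-1)%g)
}.

#[short(type="topologicalGroupType")]
HB.structure Definition TopologicalGroup :=
  {G of PreTopologicalGroup G & PreTopologicalGroup_isTopologicalGroup G}.

Definition separable_space (T : topologicalType) : Prop :=
  exists2 S : set T, countable S & dense S.

Definition completely_metrizable (R : realType) (T : topologicalType) : Prop :=
  exists (M : metricType R) (f : T -> M) (g : M -> T),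
    [/\ cancel f g, cancel g f, continuous f, continuous g
      & forall F : set_system M, ProperFilter F -> cauchy F -> exists x : M, F --> x].

Definition polish_space (R : realType) (T : topologicalType) : Prop :=
  separable_space T /\ completely_metrizable R T.

(* [dl_emb n] identifies [dl_group n] with the n-th subgroup of [G]; only the
   abstract group [dl_group n] carries the topology of that subgroup. *)
Record polish_direct_limit (R : realType) (G : preTopologicalGroupType) :=
  PolishDirectLimit {
  dl_group : nat -> topologicalGroupType ;
  dl_emb : forall n, dl_group n -> G ;
  dl_polish : forall n, polish_space R (dl_group n) ;
  dl_emb_inj : forall n, injective (@dl_emb n) ;
  dl_embM : forall n x y, dl_emb (x * y)%g = (dl_emb x * @dl_emb n y)%g ;
  dl_topological_subgroup : forall n,
    exists2 j : dl_group n -> dl_group n.+1,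
      (forall x, dl_emb (j x) = dl_emb x) &
      (forall U : set (dl_group n),
         open U <-> exists2 V : set (dl_group n.+1), open V & U = j @^-1` V) ;
  dl_cover : \bigcup_n range (@dl_emb n) = [set: G] ;
  dl_open : forall U : set G, open U <-> forall n, open (@dl_emb n @^-1` U)
}.

Definition is_subgroup (G : groupType) (K : set G) : Prop :=
  [/\ K 1%g, (forall x y, K x -> K y -> K (x * y)%g)
    & (forall x, K x -> K (x^-1)%g)].

Section ComplexMeasures.
Context {R : realType}.

Local Notation Re := (@complex.Re R).
Local Notation Im := (@complex.Im R).

Section Topological.
Context {T : ptopologicalType}.

Definition borel (A : set T) : Prop := (@open T).-sigma.-measurable A.

(* A complex measure is represented by a function on all subsets which is 0 on
   the non-Borel ones, so that Leibniz equality is equality of measures. *)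
Definition complex_measure (mu : set T -> R[i]) : Prop :=
  (forall A, ~ borel A -> mu A = 0) /\
  (forall F : (set T)^nat, (forall n, borel (F n)) -> trivIset setT F ->
     (fun n => \sum_(0 <= k < n) mu (F k) : R[i]^o) @ \oo
       --> (mu (\bigcup_n F n) : R[i]^o)).

Definition compactly_supported (mu : set T -> R[i]) : Prop :=
  exists2 C : set T, compact C &
    forall A, borel A -> A `&` C = set0 -> mu A = 0.

(* The positive part of the Jordan decomposition of a finite signed measure;
   the negative part is the upper variation of the opposite measure. *)
Definition upper_variation (nu : set T -> R) (A : set T) : \bar R :=
  ereal_sup [set (nu B)%:E | B in [set B | borel B /\ B `<=` A]].

Definition signed_integral (nu : set T -> R) (f : T -> R) : R :=
  let int (m : set (g_sigma_algebraType (@open T)) -> \bar R) :=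
    fine (\int[m]_(x in setT) (f x)%:E) in
  int (upper_variation nu) - int (upper_variation (fun A => - nu A)).

Definition cintegral (mu : set T -> R[i]) (f : T -> R[i]) : R[i] :=
  let int p q := signed_integral (fun A => p (mu A)) (fun x => q (f x)) in
  (int Re Re - int Im Im) +i* (int Re Im + int Im Re).

Definition product_cmeasure (mu nu : set T -> R[i]) (E : set (T * T)) : R[i] :=
  cintegral mu (fun x => nu (xsection E x)).

End Topological.

Section MeasureAlgebra.
Context {G : preTopologicalGroupType}.

Definition convolution (mu nu : set G -> R[i]) : set G -> R[i] :=
  fun A => product_cmeasure mu nu ((fun p : G * G => (p.1 * p.2)%g) @^-1` A).

Definition mstar (mu : set G -> R[i]) : set G -> R[i] :=
  fun A => (mu ((fun g : G => (g^-1)%g) @^-1` A))^*.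

Definition measure_algebra : set (set G -> R[i]) :=
  [set mu | complex_measure mu /\ compactly_supported mu].

Definition biinvariant_algebra (K : set G) : set (set G -> R[i]) :=
  [set mu | measure_algebra mu /\
     forall k, K k -> forall A,
       mu ((fun g : G => (k * g)%g) @^-1` A) = mu A /\
       mu ((fun g : G => (g * k)%g) @^-1` A) = mu A].

End MeasureAlgebra.
End ComplexMeasures.

(* The inner product is linear in its first argument. *)
HB.mixin Record isHilbert (R : realType) V & CompleteNormedModule R[i] V := {
  dotp : {dot V for (@Num.conj R[i])} ;
  dotp_norm : forall v : V, `|v| ^+ 2 = dotp v v
}.

#[short(type="hilbertType")]
HB.structure Definition Hilbert (R : realType) :=
  {V of CompleteNormedModule R[i] V & isHilbert R V}.

Arguments dotp {R s}.

Record unitary_rep (R : realType) (G : preTopologicalGroupType)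
    (H : hilbertType R) := UnitaryRep {
  urep :> G -> {linear H -> H} ;
  urep1 : forall x, urep 1%g x = x ;
  urepM : forall g h x, urep (g * h)%g x = urep g (urep h x) ;
  urep_dotp : forall g x y, dotp (urep g x) (urep g y) = dotp x y ;
  urep_continuous : forall x, continuous (fun g => urep g x)
}.

Section Representations.
Context {R : realType} {G : preTopologicalGroupType}.

Definition fixed_vectors (H : hilbertType R) (rho : unitary_rep G H)
    (K : set G) : set H :=
  [set x | forall k, K k -> rho k x = x].

Definition cyclic_set (H : hilbertType R) (rho : unitary_rep G H)
    (S : set H) : Prop :=
  dense [set x | exists (n : nat) (c : 'I_n -> R[i]) (g : 'I_n -> G)
                   (eta : 'I_n -> H),
           (forall i, S (eta i)) /\ x = \sum_(i < n) c i *: rho (g i) (eta i)].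

Definition unitarily_equivalent (H H' : hilbertType R)
    (rho : unitary_rep G H) (rho' : unitary_rep G H') : Prop :=
  exists U : {linear H -> H'},
    [/\ forall x y, dotp (U x) (U y) = dotp x y,
        range U = setT
      & forall g x, U (rho g x) = rho' g (U x)].

(* The weak integral of [rho g x] with respect to [mu]; the default value 0 is
   never used when [mu] belongs to the measure algebra. *)
Definition measure_op (H : hilbertType R) (rho : unitary_rep G H)
    (mu : set G -> R[i]) (x : H) : H :=
  xget 0 [set z | forall y, dotp z y = cintegral mu (fun g => dotp (rho g x) y)].

(* Only the values of a *-representation on the algebra of K-biinvariant
   measures are constrained. *)
Record star_rep (K : set G) (V : hilbertType R) := StarRep {
  srep :> (set G -> R[i]) -> {linear V -> V} ;
  srep_continuous : forall mu, biinvariant_algebra K mu -> continuous (srep mu) ;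
  srepD : forall mu nu v, biinvariant_algebra K mu -> biinvariant_algebra K nu ->
    srep (fun A => mu A + nu A) v = srep mu v + srep nu v ;
  srepZ : forall a mu v, biinvariant_algebra K mu ->
    srep (fun A => a * mu A) v = a *: srep mu v ;
  srepM : forall mu nu v, biinvariant_algebra K mu -> biinvariant_algebra K nu ->
    srep (convolution mu nu) v = srep mu (srep nu v) ;
  srep_star : forall mu v w, biinvariant_algebra K mu ->
    dotp (srep (mstar mu) v) w = dotp v (srep mu w)
}.

(* Equivalence of [tau] with the restriction of [measure_op rho] to the K-fixed
   vectors, a subspace which is not made into a [hilbertType] of its own: it is
   the range of the isometry [U]. *)
Definition equivalent_to_Res (K : set G) (V H : hilbertType R)
    (tau : star_rep K V) (rho : unitary_rep G H) : Prop :=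
  exists U : {linear V -> H},
    [/\ forall v w, dotp (U v) (U w) = dotp v w,
        range U = fixed_vectors rho K
      & forall mu, biinvariant_algebra K mu ->
          forall v, U (tau mu v) = measure_op rho mu (U v)].

End Representations.

(* Main.v *)
Require Import Defs.
From HB Require Import structures.
From mathcomp Require Import all_boot all_order all_algebra.
From mathcomp Require Import all_classical all_reals all_analysis.
From mathcomp Require Import measurable_realfun.
From mathcomp Require Import complex.
From mathcomp Require Import finmap.
From mathcomp Require Import ring lra zify.

(** A representation whose [K]-fixed vectors are cyclic is determined by the
    matrix coefficients [<rho(g) x, y>] at [K]-fixed [x] and [y]: by unitarity
    these give all inner products between the vectors [rho(g) x], which span a
    dense subspace.  These coefficients can be read off the representation of
    the algebra of biinvariant measures.  Indeed, let [nu] be a [K]-biinvariant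
    probability measure carried by the double coset [K g K].  For [K]-fixed [x]
    and [y] the function [h |-> <rho(h) x, y>] is constant on [K g K], so
    [<rho(nu) x, y> = <rho(g) x, y>] ([measure_op_double_coset]), while
    [rho(nu)] is [tau(nu)] up to the identification of [V] with the fixed
    vectors.  Two representations inducing the same [tau] thus have the same
    coefficients, so that matching the linear combinations of vectors
    [rho(g) x] with those of [rho'(g) x'], for [x] and [x'] the images of the same
    vector of [V], is a densely defined isometric relation with dense range; its
    closure is the graph of the unitary intertwiner
    ([unitary_of_dense_isometry]).

    The analytic content is the existence of [nu] ([biinvariant_probability]).
    A compact subset of the direct limit lies in one of the groups, and is
    compact there, so that [K] and [g] may be placed in one Polish group.  There
    [K g K] is compact and metrizable, and the supremum of a metric over all
    two-sided translations by [K] is again a continuous metric, for which the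
    translations are isometries ([double_coset_measure]).  Every nonempty
    compact pseudometric space carries a Borel probability measure invariant
    under all bijective isometries ([isometry_invariant_measure]): normalised
    covering numbers have a limit, along an ultrafilter, that is an invariant
    content, additive on sets at positive distance, and the outer measure that
    it defines through open covers is Borel by Caratheodory's criterion.

    The vector [rho(nu) x] is only given by its inner products; that it exists
    is the Riesz representation theorem ([riesz_representation]). *)

Set Implicit Arguments.
Unset Strict Implicit.
Unset Printing Implicit Defensive.

Import Order.TTheory GRing.Theory Num.Theory.
Import numFieldNormedType.Exports.

Local Open Scope classical_set_scope.
Local Open Scope ring_scope.

(** * Isometry-invariant probability on a compact pseudometric space *)

Section CoveringNumbers.
Context {R : realType} {T : pseudoPMetricType R}.
Implicit Types (A B : set T) (e : R) (n : nat).

Definition ball_cover A e n : Prop :=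
  exists2 s : seq T, size s = n & forall y, A y -> exists2 x, x \in s & ball x e y.

(** The value 0 is a default for sets without a finite cover; in a compact space
    every set has one for each positive radius. *)
Definition covering_number A e : nat :=
  if pselect (exists n, `[< ball_cover A e n >]) is left h then ex_minn h else 0.

Hypothesis cT : compact [set: T].

Lemma ball_cover_exists e : 0 < e -> exists n, ball_cover setT e n.
Proof.
move=> e0; move: cT; rewrite compact_cover.
move=> /(_ T setT (fun x => (ball x e)°)) [||D _ sD].
- by move=> x _; exact: open_interior.
- move=> y _; exists y => //; apply: nbhs_singleton; apply: nbhs_interior.
  exact: nbhsx_ballx.
- exists (size (enum_fset D)), (enum_fset D) => // y /sD[x xD xy].
  by exists x => //; exact: interior_subset.
Qed.

Lemma covering_numberP A e : 0 < e -> ball_cover A e (covering_number A e).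
Proof.
move=> e0; rewrite /covering_number; case: pselect => [h|[]].
  by case: ex_minnP => m /asboolP.
have [n [s sn sT]] := ball_cover_exists e0.
by exists n; apply/asboolP; exists s => // y _; exact: sT.
Qed.

Lemma covering_number_le A e n : ball_cover A e n -> (covering_number A e <= n)%N.
Proof.
rewrite /covering_number => /asboolP An; case: pselect => // h.
by case: ex_minnP => m _; apply.
Qed.

Lemma covering_numberS A B e : 0 < e -> A `<=` B ->
  (covering_number A e <= covering_number B e)%N.
Proof.
move=> /(covering_numberP B)[s <- sB] AB; apply: covering_number_le.
by exists s => // y /AB /sB.
Qed.

Lemma covering_number0 e : covering_number set0 e = 0%N.
Proof. by apply/eqP; rewrite -leqn0; apply: covering_number_le; exists [::]. Qed.

Lemma covering_numberT_gt0 e : 0 < e -> (0 < covering_number setT e)%N.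
Proof.
move=> /(covering_numberP setT)[s <- sT].
by have [x] := sT point I; case: s sT.
Qed.

Lemma covering_numberU A B e : 0 < e ->
  (covering_number (A `|` B) e <= covering_number A e + covering_number B e)%N.
Proof.
move=> e0; have [s <- sA] := covering_numberP A e0.
have [t <- tB] := covering_numberP B e0.
apply: covering_number_le; exists (s ++ t); first by rewrite size_cat.
by move=> y [/sA|/tB] [x xs xy]; exists x => //; rewrite mem_cat xs ?orbT.
Qed.

(** A ball of radius [e] cannot meet two sets that are [e + e] apart, so an
    optimal cover of the union splits into covers of the two parts. *)
Lemma covering_number_separated A B e : 0 < e ->
  (forall a b, A a -> B b -> ~ ball a (e + e) b) ->
  (covering_number A e + covering_number B e <= covering_number (A `|` B) e)%N.
Proof.
move=> e0 sep; have [s <- sAB] := covering_numberP (A `|` B) e0.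
pose meets (C : set T) (x : T) := `[< exists2 y, C y & ball x e y >].
have cov C : C `<=` A `|` B -> (covering_number C e <= count (meets C) s)%N.
  move=> CAB; apply: covering_number_le.
  exists [seq x <- s | meets C x]; first by rewrite size_filter.
  move=> y Cy; have [x xs xy] := sAB _ (CAB _ Cy); exists x => //.
  by rewrite mem_filter xs andbT; apply/asboolP; exists y.
apply: (leq_trans (leq_add (cov A (@subsetUl _ _ _)) (cov B (@subsetUr _ _ _)))).
rewrite -count_predUI [X in (_ + X)%N](_ : _ = 0%N) ?addn0 ?count_size//.
rewrite (eq_count (a2 := pred0)) ?count_pred0// => x /=.
apply/negbTE/negP => /andP[/asboolP[a Aa xa] /asboolP[b Bb xb]].
by apply: (sep a b) => //; apply: ball_triangle xb; exact: ball_sym.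
Qed.

Lemma covering_number_isometry (f : T -> T) A e : 0 < e ->
    bijective f -> (forall x y, ball (f x) e (f y) <-> ball x e y) ->
  covering_number (f @^-1` A) e = covering_number A e.
Proof.
move=> e0 [g fK gK] fI; apply/eqP; rewrite eqn_leq; apply/andP; split.
  have [s <- sA] := covering_numberP A e0.
  apply: covering_number_le; exists (map g s); first by rewrite size_map.
  move=> y /= /sA[x xs xy]; exists (g x); first exact: map_f.
  by apply/fI; rewrite gK.
have [s <- sA] := covering_numberP (f @^-1` A) e0.
apply: covering_number_le; exists (map f s); first by rewrite size_map.
move=> y Ay; have [|x xs xz] := sA (g y); first by rewrite /= gK.
by exists (f x); [exact: map_f|rewrite -(gK y); exact/fI].
Qed.

End CoveringNumbers.

Section InvariantContent.
Context {R : realType} {T : pseudoPMetricType R}.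

Definition isometric_bijection (f : T -> T) : Prop :=
  bijective f /\ (forall x y e, ball (f x) e (f y) <-> ball x e y).

Definition separated (A B : set T) : Prop :=
  exists2 e : R, 0 < e & forall a b, A a -> B b -> ~ ball a e b.

(** At each scale the covering number, normalised by that of the whole space,
    is invariant, monotone and subadditive, and it is additive on two sets once
    the scale is below half their distance.  All these properties pass to limits
    along an ultrafilter, which exist by compactness of [0, 1]; an upper limit
    would lose superadditivity. *)
Lemma invariant_content : compact [set: T] ->
  exists lam : set T -> R,
    [/\ lam set0 = 0 /\ lam setT = 1,
        forall A B, A `<=` B -> lam A <= lam B,
        forall A B, lam (A `|` B) <= lam A + lam B,
        forall A B, separated A B -> lam A + lam B <= lam (A `|` B)
      & forall f A, isometric_bijection f -> lam (f @^-1` A) = lam A].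
Proof.
move=> cT; have [W [UW ooW]] := ultraFilterLemma eventually_filter.
have PW : ProperFilter W by exact: ultra_proper.
pose q (A : set T) n : R := 
  (covering_number A n.+1%:R^-1)%:R / (covering_number [set: T] n.+1%:R^-1)%:R.
have r0 n : 0 < n.+1%:R^-1 :> R by rewrite invr_gt0.
have N0 n : 0 < (covering_number [set: T] n.+1%:R^-1)%:R :> R.
  by rewrite ltr0n covering_numberT_gt0.
(* the ratios lie in [0, 1], where every ultrafilter converges *)
have cvgq A : cvg (q A @ W).
  have qA01 : (q A @ W) [set` `[0, 1]].
    apply: (@filterE _ W) => n; rewrite /= in_itv/= divr_ge0 ?ler0n//=.
    by rewrite ler_pdivrMr ?mul1r ?ler_nat ?N0//; exact: covering_numberS.
  have [l [_ ll]] := @segment_compact R 0 1 _ (fmap_proper_filter _ PW) qA01.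
  apply/cvg_ex; exists l => U lU.
  have [//|WU] := in_ultra_setVsetC (q A @^-1` U) UW.
  by have [x []] := ll (~` U) U WU lU.
have cvgl A : q A @ W --> lim (q A @ W) by exact: cvgq.
exists (fun A => lim (q A @ W)); split.
- split.
    rewrite (_ : q set0 = cst 0); first by rewrite lim_cst.
    by apply/funext => n; rewrite /q covering_number0 mul0r.
  rewrite (_ : q setT = cst 1); first by rewrite lim_cst.
  by apply/funext => n; rewrite /q divff// gt_eqF.
- move=> A B AB; apply: ler_lim => //; apply: filterE => n.
  by rewrite ler_pM2r ?invr_gt0// ler_nat; exact: covering_numberS.
- move=> A B; rewrite -limD//; apply: ler_lim => //; first exact: is_cvgD.
  apply: filterE => n.
  rewrite -[leRHS]/(q A n + q B n) -mulrDl ler_pM2r ?invr_gt0// -natrD ler_nat.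
  exact: covering_numberU.
- move=> A B [e e0 sep]; rewrite -limD//; apply: ler_lim => //; first exact: is_cvgD.
  have e20 : 0 < e / 2 by exact: divr_gt0.
  apply: ooW; apply: filterS (near_infty_natSinv_lt (PosNum e20)) => n /= re.
  rewrite -[leLHS]/(q A n + q B n) -mulrDl ler_pM2r ?invr_gt0// -natrD ler_nat.
  apply: covering_number_separated => // a b Aa Bb ab; apply: (sep a b) => //.
  apply: le_ball ab; by rewrite [leRHS]splitr ltW// ltrD.
- move=> f A [f_bij fI]; congr (lim (_ @ W)); apply/funext => n.
  by rewrite /q covering_number_isometry.
Qed.

End InvariantContent.

Section MetricOuterMeasure.
Context {R : realType} {T : pseudoPMetricType R}.

(** Caratheodory's criterion.  The part of [X] inside the open set [U] is
    exhausted by the sets [inner n] of points at distance at least [1/(n+1)]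
    from the complement of [U]; what is missing from [inner n] has small outer
    measure because [inner n] and [inner n.+2 `\` inner n.+1] are separated, so
    that the measures of the shells are dominated by a telescoping sum. *)
Lemma open_caratheodory (mu : {outer_measure set T -> \bar R}) (U : set T) :
    mu setT \is a fin_num ->
    (forall A B, separated A B -> (mu A + mu B <= mu (A `|` B))%E) ->
  open U -> mu.-caratheodory U.
Proof.
move=> muT_fin sepmu oU; apply: le_caratheodory_measurable => X.
have mufin A : mu A \is a fin_num.
  rewrite ge0_fin_numE ?outer_measure_ge0//; apply: (@le_lt_trans _ _ (mu setT)).
    exact: le_outer_measure.
  by rewrite ltey_eq muT_fin.
pose r n : R := n.+1%:R^-1.
have r0 n : 0 < r n by rewrite invr_gt0.
have rS n : r n.+1 < r n by rewrite ltf_pV2 ?posrE// ltr_nat.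
pose inner n := [set x | X x /\ forall y, ~ U y -> ~ ball x (r n) y].
pose m A := fine (mu A).
have mE A : mu A = (m A)%:E by rewrite fineK.
have mS A B : A `<=` B -> m A <= m B.
  by move=> AB; rewrite -lee_fin -!mE; exact: le_outer_measure.
have msep A B : separated A B -> m A + m B <= m (A `|` B).
  by move=> AB; rewrite -lee_fin EFinD -!mE; exact: sepmu.
have innerS n : inner n `<=` inner n.+1.
  move=> x [Xx h]; split => // y /h; apply: contra_not; apply: le_ball.
  by rewrite ltW.
have inner_mono p q : (p <= q)%N -> inner p `<=` inner q.
  move=> /subnKC <-; elim: (q - p)%N => [|k IH]; first by rewrite addn0.
  by rewrite addnS => x /IH /innerS.
pose shell n := inner n.+1 `\` inner n.
have inner_shell n : m (inner n) + m (shell n.+1) <= m (inner n.+2).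
  apply: le_trans (mS (inner n `|` shell n.+1) _ _); last first.
    by rewrite subUset; split; [move=> x /innerS/innerS|exact: subIsetl].
  apply: msep; exists (r n - r n.+1); first by rewrite subr_gt0.
  move=> a b [Xa ha] [[Xb _] /not_andP[//|]].
  move=> /existsNP[y /not_implyP[Uy /contrapT by_]] ab.
  by apply: (ha y Uy); rewrite -[r n](subrK (r n.+1)); exact: ball_triangle by_.
have inner_sep n : m (inner n) + m (X `&` ~` U) <= m X.
  apply: le_trans (mS (inner n `|` (X `&` ~` U)) _ _); last first.
    by rewrite subUset; split; [move=> x []|exact: subIsetl].
  apply: msep; exists (r n) => // a b [Xa ha] [_ Ub]; exact: ha.
have shells N k : \sum_(i < k) m (shell (N + i).+1%N) <=
    m (inner (N + k).+1%N) + m (inner (N + k)%N) - m (inner N.+1) - m (inner N).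
  elim: k => [|k IH]; first by rewrite big_ord0 !addn0; lra.
  rewrite big_ord_recr/= !addnS; have := inner_shell (N + k)%N; lra.
pose S := range (fun n => m (inner n)).
have supS : has_sup S.
  split; first by exists (m (inner 0)), 0%N.
  by exists (m X) => _ [n _ <-]; apply: mS => x [].
have leS n : m (inner n) <= sup S by apply: ub_le_sup; [exact: supS.2|exists n].
have cover N : (mu (X `&` U) <= (m (inner N.+1) + 2 * (sup S - m (inner N)))%:E)%E.
  apply: (@le_trans _ _ (mu (inner N.+1 `|` \bigcup_k shell (N + k).+1%N))).
    apply: le_outer_measure => x [Xx Ux].
    have [_/posnumP[e] xeU] : exists2 e : R, 0 < e & ball x e `<=` U.
      by have /nbhs_ballP[e e0 xe] := open_nbhs_nbhs (conj oU Ux); exists e.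
    have [n re] : exists n, r n < e%:num.
      have [n _ /(_ n (leqnn n))] := near_infty_natSinv_lt e; by exists n.
    have xn : inner n x.
      split=> // y Uy xy; apply: Uy; apply: xeU; exact: (le_ball (ltW re)).
    have : exists n, `[< inner n x >] by exists n; exact/asboolP.
    move=> ex; case: (ex_minnP ex) => p /asboolP px pmin.
    have [pN|Np] := leqP p N.+1.
      by left; exact: inner_mono px.
    right; exists (p.-1 - N.+1)%N => //.
    have -> : ((N + (p.-1 - N.+1)).+1 = p.-1)%N by lia.
    split; first by rewrite prednK//; lia.
    by move=> /asboolP /pmin; lia.
  apply: (le_trans (outer_measureU2 _ _ _)); rewrite EFinD -mE leeD2l//.
  apply: (le_trans (outer_measure_sigma_subadditive _ _)).
  apply: lime_le; first by apply: is_cvg_nneseries => n _ _; exact: outer_measure_ge0.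
  apply: nearW => k; rewrite big_mkord
    (eq_bigr (fun i : 'I_k => (m (shell (N + i).+1%N))%:E)) //.
  rewrite sumEFin lee_fin; apply: (le_trans (shells N k)).
  have := leS (N + k)%N; have := leS (N + k).+1%N; have := mS _ _ (@innerS N); lra.
apply/lee_addgt0Pr => e e0.
have e40 : 0 < e / 4 by rewrite divr_gt0.
have [_ [N _ <-] supN] := sup_adherent e40 supS.
rewrite [mu X]mE [mu (X `&` ~` U)]mE.
apply: (le_trans (leeD2r _ (cover N))); rewrite -!EFinD lee_fin.
have := inner_sep N.+1; have := leS N.+1; have := inner_sep N; lra.
Qed.

End MetricOuterMeasure.

Section OuterMeasureOfContent.
Context {R : realType} {T : ptopologicalType}.

(** The discrete copy of [T] makes every set admissible in [mu_ext]; giving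
    non-open sets infinite weight then restricts the covers to open ones. *)
Definition open_weight (lam : set T -> R) (A : set (g_sigma_algebraType [set: set T])) :
  \bar R := if `[< open (A : set T) >] then (lam A)%:E else +oo%E.

(** [mu A] is the infimum of the total weight over countable open covers, given
    by the two inequalities that characterise an infimum. *)
Lemma open_cover_outer_measure (lam : set T -> R) :
    (forall B, 0 <= lam B) -> lam set0 = 0 ->
  exists mu : {outer_measure set T -> \bar R},
    (forall A (F : (set T)^nat), (forall n, open (F n)) -> A `<=` \bigcup_n F n ->
      mu A <= \sum_(n <oo) (lam (F n))%:E)%E /\
    (forall A x, (forall F : (set T)^nat, (forall n, open (F n)) ->
        A `<=` \bigcup_n F n -> x <= \sum_(n <oo) (lam (F n))%:E) -> x <= mu A)%E.
Proof.
move=> lam0 lam00.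
have w0 A : (0 <= open_weight lam A)%E.
  by rewrite /open_weight; case: asboolP; rewrite ?lee_fin ?leey.
have wE (F : (set T)^nat) : (forall n, open (F n)) ->
    (\sum_(n <oo) (lam (F n))%:E = \sum_(n <oo) open_weight lam (F n))%E.
  by move=> oF; apply: eq_eseriesr => n _; rewrite /open_weight asboolT.
have w00 : open_weight lam set0 = 0%E.
  by rewrite /open_weight asboolT ?lam00//; exact: open0.
pose mu (A : set T) := mu_ext (open_weight lam) A.
pose m := isOuterMeasure.Build R T mu (mu_ext0 w00 w0) (mu_ext_ge0 w0)
  (le_mu_ext (open_weight lam)) (mu_ext_sigma_subadditive w0).
exists (HB.pack_for (outer_measure R T) mu m); split.
  move=> A F oF AF; rewrite wE//; apply: ereal_inf_lbound; exists F => //.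
  by split=> // n; exact: sub_gen_smallest.
move=> A x xF; apply: le_ereal_inf_tmp => _ [F [_ AF] <-].
have [oF|/existsNP[n nF]] := pselect (forall n, open (F n : set T)).
  by rewrite -wE//; exact: xF.
rewrite (eseries_pinfty (k := n)) ?leey//; last by rewrite /open_weight asboolF.
by move=> k _; rewrite -ltNye (lt_le_trans _ (w0 _)).
Qed.

End OuterMeasureOfContent.

(** Restricting to open covers is what gives [mu] total mass 1: by compactness
    a cover of the space has a finite subcover, so finite subadditivity of the
    content bounds its weight below by 1.  To bound the weight of a cover of two
    separated sets, the cover is cut by disjoint neighbourhoods of the two sets,
    still separated, on which the content is additive. *)
Theorem isometry_invariant_measure (R : realType) (T : pseudoPMetricType R) :
    compact [set: T] ->
  exists mu : {outer_measure set T -> \bar R},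
    [/\ mu setT = 1%E, forall U, open U -> mu.-caratheodory U
      & forall f A, isometric_bijection f -> mu (f @^-1` A) = mu A].
Proof.
move=> cT; have [lam [[lam0 lamT] lamS lamU lam_sep lamI]] := invariant_content cT.
have lam_ge0 B : 0 <= lam B by rewrite -lam0; exact: lamS.
have [mu [mu_cover mu_inf]] := open_cover_outer_measure lam_ge0 lam0.
have muT : mu setT = 1%E.
  apply/eqP; rewrite eq_le; apply/andP; split.
    apply: (le_trans (mu_cover _ (fun n => if n is 0%N then setT else set0) _ _)).
    - by case=> [|n]; [exact: openT|exact: open0].
    - by move=> x _; exists 0%N.
    rewrite nneseries_recl//; last by move=> n _; rewrite lee_fin.
    by rewrite lamT eseries_cond/= eseries0 ?adde0// => -[|k]//= _ _; rewrite lam0.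
  apply: mu_inf => F oF sF.
  have : near_covering [set: T] by apply/compact_near_coveringP.
  move=> /(_ nat \oo (fun n x => (\big[setU/set0]_(i < n) F i) x) _).
  move=> [|N _ /(_ N (leqnn N)) FN].
    move=> x _; have [k _ Fkx] := sF x I.
    exists ((F k : set T), [set n | (k < n)%N]).
      by split; [exact: (open_nbhs_nbhs (conj (oF k) Fkx))|exact: nbhs_infty_gt].
    by move=> [y n] [/= Fky kn]; rewrite -bigcup_mkord; exists k.
  have sub n : lam (\big[setU/set0]_(i < n) F i) <= \sum_(i < n) lam (F i).
    elim: n => [|n IH]; first by rewrite !big_ord0 lam0.
    by rewrite !big_ord_recr/=; apply: le_trans (lamU _ _) _; rewrite lerD2r.
  apply: (@le_trans _ _ (\sum_(0 <= i < N) (lam (F i))%:E)%E); last first.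
    by apply: nneseries_lim_ge => k _ _; rewrite lee_fin.
  rewrite big_mkord sumEFin lee_fin -lamT; apply: le_trans (sub N).
  by apply: lamS => x _; exact: FN.
have mu_sep A B : separated A B -> (mu A + mu B <= mu (A `|` B))%E.
  move=> [e e0 AB]; apply: mu_inf => F oF ABF.
  have e30 : 0 < e / 3 by exact: divr_gt0.
  (* balls of radius a third of the distance of [A] and [B] leave a third between
     the two neighbourhoods *)
  pose hull (C : set T) := \bigcup_(c in C) (ball c (e / 3))°.
  have hull_open C : open (hull C) by apply: bigcup_open => c _; exact: open_interior.
  have sub_hull C : C `<=` hull C.
    move=> c Cc; exists c => //; apply: nbhs_singleton; apply: nbhs_interior.
    exact: nbhsx_ballx.
  have hull_sep : separated (hull A) (hull B).
    exists (e / 3) => // a' b' [a Aa /interior_subset aa'].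
    move=> [b Bb /interior_subset bb'] a'b'.
    apply: (AB a b Aa Bb); rewrite (_ : e = e / 3 + e / 3 + e / 3); last by lra.
    by apply: ball_triangle (ball_sym bb'); exact: ball_triangle a'b'.
  have mu_hull C : C `<=` A `|` B -> (mu C <= \sum_(n <oo) (lam (F n `&` hull C))%:E)%E.
    move=> CAB; apply: mu_cover => [n|x Cx]; first exact: openI.
    by have [n _ Fnx] := ABF x (CAB _ Cx); exists n => //; split => //; exact: sub_hull.
  apply: (le_trans (leeD (mu_hull A _) (mu_hull B _))).
  - exact: subsetUl.
  - exact: subsetUr.
  rewrite -nneseriesD; [|by move=> n _ _; rewrite lee_fin..].
  apply: lee_nneseries => n _; first by rewrite -EFinD lee_fin addr_ge0.
  rewrite -EFinD lee_fin; apply: le_trans (lam_sep _ _ _) _.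
    by case: hull_sep => d d0 h; exists d => // a b [_ ?] [_ ?]; exact: h.
  by rewrite -setIUr; apply: lamS; exact: subIsetl.
have mu_isom f A : isometric_bijection f -> (mu (f @^-1` A) <= mu A)%E.
  move=> fI; apply: mu_inf => F oF AF.
  under eq_eseriesr do rewrite -(lamI f)//.
  apply: mu_cover => [n|x /AF[n _ Fnx]]; last by exists n.
  rewrite openE => x /= Fx; have /nbhs_ballP[e e0 xe] := open_nbhs_nbhs (conj (oF n) Fx).
  by apply/nbhs_ballP; exists e => // y xy; apply: xe; exact/fI.2.
exists mu; split => //.
  by move=> U oU; apply: open_caratheodory => //; rewrite muT.
move=> f A fI; apply/eqP; rewrite eq_le mu_isom//=.
have [[g fK gK] fB] := fI.
rewrite {1}(_ : A = g @^-1` (f @^-1` A)); last by apply/funext => x /=; rewrite gK.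
by apply: mu_isom; split=> [|x y e]; [exists f|rewrite -fB !gK].
Qed.

(** * Compact subsets and translations in a direct limit of Polish groups *)

Lemma continuous_mulg (H : topologicalGroupType) (T : topologicalType) (f g : T -> H) x :
  continuous_at x f -> continuous_at x g ->
  continuous_at x (fun y => (f y * g y)%g).
Proof.
move=> cf cg.
have := @continuous2_cvg _ _ _ _ (nbhs x) _ f g (fun a b => (a * b)%g) _ _ _ cf cg.
by apply; exact: (@mulg_continuous H (f x, g x)).
Qed.

Section DirectLimit.
Context {R : realType} {G : preTopologicalGroupType} (L : polish_direct_limit R G).
Local Notation emb := (@dl_emb R G L _).

Lemma dl_emb_le n m : (n <= m)%N ->
  exists2 j : dl_group L n -> dl_group L m,
    (forall x, emb (j x) = emb x) &
    (forall U, open U <-> exists2 V, open V & U = j @^-1` V).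
Proof.
move=> /subnKC <-; elim: (m - n)%N => [|k [j jE jo]].
  by rewrite addn0; exists id => // U; split=> [oU|[V oV ->]//]; exists U.
rewrite addnS; have [i iE io] := dl_topological_subgroup L (n + k).
exists (i \o j) => [x|U]; first by rewrite /= iE.
split=> [/jo[V /io[W oW ->] ->]|[W oW ->]]; first by exists W.
by apply/jo; exists (i @^-1` W) => //; apply/io; exists W.
Qed.

Lemma dl_emb_continuous n : continuous (@dl_emb R G L n).
Proof. by apply/continuousP => U /dl_open; apply. Qed.

Lemma dl_emb1 n : @dl_emb R G L n 1%g = 1%g.
Proof.
apply: (@mulgI _ (@dl_emb R G L n 1%g)).
by rewrite -dl_embM !mulg1.
Qed.

Lemma dl_embV n x : @dl_emb R G L n x^-1%g = (emb x)^-1%g.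
Proof. by apply: (@mulgI _ (emb x)); rewrite -dl_embM !mulgV dl_emb1. Qed.

(** An open set of the [n]-th group is the trace of the union of all open sets
    of the later groups whose trace it contains. *)
Lemma dl_emb_open n (U : set (dl_group L n)) : open U ->
  exists2 W : set G, open W & U = @dl_emb R G L n @^-1` W.
Proof.
move=> oU.
pose D m := [set V : set (dl_group L m) | [/\ (n <= m)%N, open V
  & forall x : dl_group L n, (exists2 v, V v & emb v = emb x) -> U x]].
exists [set y | exists m, exists2 V, D m V & (@dl_emb R G L m @` V) y].
  apply/dl_open => m; rewrite openE => x /= [k [V [nk oV VU] [v Vv vx]]].
  have [km|/ltnW mk] := leqP k m.
    have [j jE jo] := dl_emb_le km; have /jo[V' oV' VE] := oV.
    have xj : x = j v by apply: (@dl_emb_inj R G L); rewrite jE.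
    apply: filterS (open_nbhs_nbhs (conj oV' (_ : V' x))); last first.
      by rewrite xj; move: Vv; rewrite VE.
    move=> y V'y; exists m, V'; last by exists y.
    split=> // [|z [w V'w wz]]; first exact: leq_trans km.
    have [i iE _] := dl_emb_le nk.
    apply: VU; exists (i z) => //; rewrite VE /= (_ : j (i z) = w)//.
    by apply: (@dl_emb_inj R G L); rewrite jE iE.
  have [j jE jo] := dl_emb_le mk.
  have oj : open (j @^-1` V) by apply/jo; exists V.
  apply: filterS (open_nbhs_nbhs (conj oj (_ : V (j x)))).
    by move=> y Vy; exists k, V => //; exists (j y).
  by rewrite (_ : j x = v)//; apply: (@dl_emb_inj R G L); rewrite jE.
apply/seteqP; split=> [x Ux|x /= [m [V [_ _ VU] [v Vv vx]]]].
  exists n, U; last by exists x.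
  by split=> // y [v Uv /dl_emb_inj <-].
by apply: VU; exists v.
Qed.

Lemma dl_group_accessible n : accessible_space (dl_group L n).
Proof.
have [_ [M [f [g [fK _ cf _ _]]]]] := dl_polish L n.
move=> x y xy; have fxy : f x != f y by rewrite (can_eq fK).
have [A [oA xA yA]] := hausdorff_accessible (@metric_hausdorff _ M) fxy.
exists (f @^-1` A); split; last 2 first.
- exact/mem_set/(set_mem xA).
- exact/mem_set/(set_mem yA).
- by apply: open_comp => // z _; exact: cf.
Qed.

(** Otherwise choose [x k] in [C] outside the [k]-th group.  Each group contains
    finitely many of these points, so the complements of the tails of the
    sequence are open; they increase to [G], so that one of them contains the
    compact set [C], although it misses points of the sequence. *)
Lemma compact_sub_dl_group (C : set G) : compact C ->
  exists n, C `<=` range (@dl_emb R G L n).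
Proof.
move=> cC; apply: contrapT => /forallNP nC.
have ex n : exists x, C x /\ ~ range (@dl_emb R G L n) x.
  by have /existsNP[x /not_implyP] := nC n; exists x.
have [x xP] := choice ex.
have range_le n m y : (n <= m)%N -> range (@dl_emb R G L n) y -> range (@dl_emb R G L m) y.
  by move=> nm [z _ <-]; have [j jE _] := dl_emb_le nm; exists (j z).
have oO n : open (~` [set x k | k in [set k | (n <= k)%N]]).
  apply/dl_open => m; rewrite preimage_setC; apply: closed_openC.
  move/accessible_finite_set_closed: (@dl_group_accessible m); apply.
  apply: (@sub_finite_set _ _ (@dl_emb R G L m @^-1` (x @` `I_m))).
    move=> y /= [k _ xky]; exists k => //=; rewrite ltnNge; apply/negP => mk.
    by apply: (xP k).2; apply: range_le mk _; exists y.
  apply: finite_preimage; first by move=> ? ? _ _; exact: dl_emb_inj.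
  exact: finite_image.
have : near_covering C by apply/compact_near_coveringP.
move=> /(_ nat \oo (fun n => ~` [set x k | k in [set k | (n <= k)%N]]) _).
move=> [|N _ /(_ N (leqnn N)) CN].
  move=> y Cy; have [m _ my] : (\bigcup_n range (@dl_emb R G L n)) y by rewrite dl_cover.
  exists (~` [set x k | k in [set k | (m <= k)%N]], [set n | (m <= n)%N]).
    split; last exact: nbhs_infty_ge.
    apply: open_nbhs_nbhs; split; first exact: oO.
    by move=> [k mk xk]; apply: (xP k).2; rewrite xk; exact: range_le my.
  move=> [z n] [/= zm mn] [k nk xk]; apply: zm; exists k => //.
  exact: leq_trans nk.
by apply: (CN (x N) (xP N).1); exists N => /=.
Qed.

(** Holds because the topology of each group is the one induced from [G], by
    [dl_emb_open]. *)
Lemma dl_emb_preimage_compact n (C : set G) : compact C ->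
  C `<=` range (@dl_emb R G L n) -> compact (@dl_emb R G L n @^-1` C).
Proof.
move=> cC CL F PF FC; have [p [Cp pF]] := cC (emb @ F) _ FC.
have [q _ qp] := CL p Cp; rewrite -qp in Cp pF.
exists q; split=> // A B FA; rewrite nbhsE => -[U [oU Uq] UB].
have [W oW UW] := dl_emb_open oU.
have [||_ [[a Aa <-] Wa]] := pF (emb @` A) W.
- by apply: (@filterS _ F _ A) FA => x Ax; exists x.
- by apply: open_nbhs_nbhs; split=> //; move: Uq; rewrite UW.
- by exists a; split=> //; apply: UB; rewrite UW.
Qed.

(** Multiplication of [G] need not be jointly continuous, but a translation by
    [k] restricts on each group to a map into a later group that contains [k]. *)
Lemma dl_mulg_continuous (k : G) : continuous (fun x : G => (k * x)%g).
Proof.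
have [m _ [k' _ kE]] : (\bigcup_n range (@dl_emb R G L n)) k by rewrite dl_cover.
apply/continuousP => U oU; apply/dl_open => n.
have [i iE io] := dl_emb_le (leq_maxl m n).
have [j jE jo] := dl_emb_le (leq_maxr m n).
apply/jo; exists ((fun x => i k' * x)%g @^-1` (emb @^-1` U)).
  apply: open_comp; last exact: (proj1 (dl_open L U) oU).
  by move=> x _; apply: continuous_mulg; [exact: cvg_cst|exact: cvg_id].
by apply/seteqP; split=> x; rewrite /preimage/= dl_embM iE jE kE.
Qed.

Lemma dl_mulgr_continuous (k : G) : continuous (fun x : G => (x * k)%g).
Proof.
have [m _ [k' _ kE]] : (\bigcup_n range (@dl_emb R G L n)) k by rewrite dl_cover.
apply/continuousP => U oU; apply/dl_open => n.
have [i iE io] := dl_emb_le (leq_maxl m n).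
have [j jE jo] := dl_emb_le (leq_maxr m n).
apply/jo; exists ((fun x => x * i k')%g @^-1` (emb @^-1` U)).
  apply: open_comp; last exact: (proj1 (dl_open L U) oU).
  by move=> x _; apply: continuous_mulg; [exact: cvg_id|exact: cvg_cst].
by apply/seteqP; split=> x; rewrite /preimage/= dl_embM iE jE kE.
Qed.

End DirectLimit.

(** * Invariant probability on a compact double coset *)

(** Pushing forward along [i] yields a Borel measure because preimages of open
    sets are open, hence Caratheodory measurable. *)
Lemma invariant_borel_measure (R : realType) (T : pseudoPMetricType R)
    (G : ptopologicalType) (i : T -> G) : compact [set: T] -> continuous i ->
  exists m : probability (g_sigma_algebraType (@open G)) R,
    (forall A, i @^-1` A = set0 -> m A = 0%E) /\
    (forall f h A, isometric_bijection f -> i \o f =1 h \o i ->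
        m (h @^-1` A) = m A).
Proof.
move=> cT ci; have [mu [muT mu_open mu_inv]] := isometry_invariant_measure cT.
have mi : measurable_fun setT (i : caratheodory_type mu -> g_sigma_algebraType (@open G)).
  apply: (@measurability _ _ (caratheodory_type mu) (g_sigma_algebraType (@open G))
    setT i (@open G)) => // _ [U oU <-].
  rewrite setTI; apply: mu_open; move/continuousP : ci; exact.
pose m : {measure set (g_sigma_algebraType (@open G)) -> \bar R} :=
  measure_function_pushforward__canonical__measure_function_Measure
    (mu : {measure set (caratheodory_type mu) -> \bar R}) mi.
have m1 : m setT = 1%E by rewrite /m /= /pushforward preimage_setT.
exists (HB.pack_for (probability (g_sigma_algebraType (@open G)) R) (Measure.sort m)
  (Measure_isProbability.Build _ _ _ m m1)).
split=> [A A0|f h A fI fh]; rewrite /= /pushforward.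
- by rewrite A0 outer_measure0.
- rewrite -[RHS](mu_inv f)// /preimage; congr (mu _); apply/funext => x /=.
  by have /= -> := fh x.
Qed.

Section DoubleCoset.
Context {R : realType} {H : topologicalGroupType} (M : metricType R).
Variables (f : H -> M) (g : M -> H).
Hypotheses (fK : cancel f g) (f_cont : continuous f) (g_cont : continuous g).
Variables (K : set H) (subK : is_subgroup K) (cK : compact K) (x0 : H).

Definition double_coset : set H :=
  [set (p.1 * x0 * p.2)%g | p in K `*` K].

Lemma double_coset_compact : compact double_coset.
Proof.
apply: continuous_compact; last exact: compact_setX.
apply: continuous_subspaceT => p; apply: continuous_mulg; last exact: cvg_snd.
by apply: continuous_mulg; [exact: cvg_fst|exact: cvg_cst].
Qed.

Let K1 : K 1%g. Proof. by case: subK. Qed.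
Let KM a b : K a -> K b -> K (a * b)%g. Proof. by case: subK => _ KM _; exact: KM. Qed.
Let KV a : K a -> K (a^-1)%g. Proof. by case: subK => _ _ KV; exact: KV. Qed.

Let translates (x : double_coset) : arrow_uniform_type (K `*` K) M :=
  fun p => f ((val p).1 * val x * (val p).2)%g.

(** The distance in [X] is the supremum over [K * K] of the distances between
    two-sided translates, which makes all these translations isometries. *)
Let X := initial_topology translates.

Let ball_X (x y : X) e : ball x e y <->
  forall a b, K a -> K b -> ball (f (a * val x * b)%g) e (f (a * val y * b)%g).
Proof.
rewrite -[ball x e y]/(forall p : K `*` K, ball (translates x p) e (translates y p)).
split=> [xy a b Ka Kb|xy [p pK]].
  have abK : (a, b) \in K `*` K by exact/mem_set.
  exact: (xy (exist _ (a, b) abK)).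
by have [/= Ka Kb] := set_mem pK; exact: xy.
Qed.

(** The new distance is larger than the old one; compactness survives because,
    by compactness of [K * K], every ball of the new distance still contains an
    old neighbourhood of its centre. *)
Let X_compact : compact [set: X].
Proof.
have cX := double_coset_compact.
move=> F PF _; have FX : (val @ F) double_coset.
  by apply: (@filterE _ F) => x; exact: set_mem (valP x).
have [p [Xp pF]] := cX (val @ F) _ FX.
exists (exist _ p (mem_set Xp)); split=> // A B FA /nbhs_ballP[e e0 eB].
have pe : \forall y \near p, forall q, (K `*` K) q ->
    ball (f (q.1 * p * q.2)%g) e (f (q.1 * y * q.2)%g).
  have := compact_setX cK cK; rewrite compact_near_coveringP; apply => -[a b] [/= Ka Kb].
  have e20 : 0 < e / 2 by exact: divr_gt0.
  have cont : {for ((a, b), p), continuous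
      (fun z : (H * H) * H => f (z.1.1 * z.2 * z.1.2)%g)}.
    apply: (@continuous_comp _ _ _ (fun z => z.1.1 * z.2 * z.1.2)%g f); last exact: f_cont.
    apply: continuous_mulg; last first.
      by apply: (continuous_comp (f := fst) (g := snd)); [exact: cvg_fst|exact: cvg_snd].
    apply: continuous_mulg; last exact: cvg_snd.
    by apply: (continuous_comp (f := fst) (g := fst)); [exact: cvg_fst|exact: cvg_fst].
  have [[P Q] [/= Pab Qp] PQ] := cvg_ball cont e20.
  exists (P, Q) => // -[q y] [/= Pq Qy]; apply: ball_splitr (PQ (q, y) _) => //.
  by apply: (PQ (q, p)); split => //=; exact: nbhs_singleton.
have FvalA : (val @ F) (val @` A) by apply: (@filterS _ F _ A) FA => x Ax; exists x.
have [_ [[x Ax <-] xU]] := pF (val @` A) _ FvalA pe.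
exists x; split=> //; apply: eB; apply/ball_X => a b Ka Kb /=.
exact: (xU (a, b)).
Qed.

(** [K * K] acts on [X] by isometries, through left and right translations. *)
Theorem double_coset_measure (G : ptopologicalType) (i : H -> G) :
    continuous i ->
  exists m : probability (g_sigma_algebraType (@open G)) R,
    [/\ forall A, i @` double_coset `&` A = set0 -> m A = 0%E,
        forall k h A, K k -> (forall x, i (k * x)%g = h (i x)) -> m (h @^-1` A) = m A
      & forall k h A, K k -> (forall x, i (x * k)%g = h (i x)) -> m (h @^-1` A) = m A].
Proof.
move=> ci.
have x0X : x0 \in double_coset.
  by apply/mem_set; exists (1, 1)%g; rewrite //= mul1g mulg1.
pose T : pseudoPMetricType R := HB.pack (initial_topology translates)
  (isPointed.Build (initial_topology translates) (exist _ x0 x0X)).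
have cj : continuous (fun x : T => i (val (x : X))).
  move=> x; apply: (@continuous_comp T H G (fun x : T => val (x : X)) i); last exact: ci.
  have -> : (fun x : T => val (x : X)) = g \o (fun x : T => f (val (x : X))).
    by apply/funext => y /=; rewrite fK.
  apply: continuous_comp; last exact: g_cont.
  apply/(@cvg_ballP _ _ _ (nbhs x) (nbhs_filter x)) => e e0.
  apply/nbhs_ballP; exists e => // y /ball_X /(_ 1%g 1%g K1 K1).
  by rewrite !mul1g !mulg1.
have [m [m0 mI]] := invariant_borel_measure (X_compact : compact [set: T]) cj.
have KXl k (x : X) : K k -> (k * val x)%g \in double_coset.
  move=> Kk; have [[a b] [/= Ka Kb] abx] := set_mem (valP x); apply/mem_set.
  by exists (k * a, b)%g; [split => //; exact: KM|rewrite /= -abx !mulgA].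
have KXr k (x : X) : K k -> (val x * k)%g \in double_coset.
  move=> Kk; have [[a b] [/= Ka Kb] abx] := set_mem (valP x); apply/mem_set.
  by exists (a, b * k)%g; [split => //; exact: KM|rewrite /= -abx !mulgA].
exists m; split=> // [A A0|k h A Kk ih|k h A Kk ih].
- apply: m0; rewrite -subset0 => x Ax.
  suff : (i @` double_coset `&` A) (i (val (x : X))) by rewrite A0.
  by split=> //; exists (val (x : X)) => //; exact: set_mem (valP (x : X)).
- pose act c (Kc : K c) (x : X) : X := exist _ (c * val x)%g (KXl c x Kc).
  apply: (mI (act k Kk : T -> T)) => [|x]; last exact: ih.
  split=> [|x y e].
    by exists (act _ (KV Kk)) => x; apply: val_inj; rewrite /= ?mulKg ?mulVKg.
  split=> /ball_X xy; apply/ball_X => a b Ka Kb.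
    by have := xy (a * k^-1)%g b (KM Ka (KV Kk)) Kb; rewrite /= !mulgA !mulgVK.
  by have := xy (a * k)%g b (KM Ka Kk) Kb; rewrite /= !mulgA.
- pose act c (Kc : K c) (x : X) : X := exist _ (val x * c)%g (KXr c x Kc).
  apply: (mI (act k Kk : T -> T)) => [|x]; last exact: ih.
  split=> [|x y e].
    by exists (act _ (KV Kk)) => x; apply: val_inj; rewrite /= ?mulgK ?mulgVK.
  split=> /ball_X xy; apply/ball_X => a b Ka Kb.
    by have := xy a (k^-1 * b)%g Ka (KM (KV Kk) Kb); rewrite /= !mulgA !mulgK.
  by have := xy a (k * b)%g Ka (KM Kk Kb); rewrite /= !mulgA.
Qed.

End DoubleCoset.

(** * Probabilities as complex measures *)

Local Open Scope complex_scope.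

Section EqMeasurable.
Import HBNNSimple.

(** Stated for bare set functions because [upper_variation] is one: it agrees
    with the measure that it comes from on Borel sets only. *)
Lemma eq_on_measurable_integral d (T : measurableType d) (R : realType)
    (m1 m2 : set T -> \bar R) (f : T -> \bar R) :
  (forall A, measurable A -> m1 A = m2 A) ->
  (\int[m1]_(x in setT) f x = \int[m2]_(x in setT) f x)%E.
Proof.
move=> m12; rewrite /integral.
have E (g : {nnsfun T >-> R}) : sintegral m1 g = sintegral m2 g.
  by apply: eq_fsbigr => r _; rewrite m12.
by congr (ereal_sup _ - ereal_sup _)%E; apply/seteqP; split=> _ [g gf <-] /=;
  exists g.
Qed.

End EqMeasurable.

Section ProbabilityAsComplexMeasure.
Context {R : realType} {T : ptopologicalType}.
Local Notation B := (g_sigma_algebraType (@open T)).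
Local Notation Re := (@complex.Re R).
Local Notation Im := (@complex.Im R).
Variable P : probability B R.

(** Being 0 off the Borel sets makes equality of set functions equality of
    measures. *)
Definition complex_probability (A : set T) : R[i] :=
  if `[< borel A >] then (fine (P A))%:C else 0.

Lemma complex_probabilityE A : borel A -> complex_probability A = (fine (P A))%:C.
Proof. by rewrite /complex_probability => /asboolT ->. Qed.

Lemma complex_probability_measure : complex_measure complex_probability.
Proof.
split=> [A nA|F bF tF]; first by rewrite /complex_probability asboolF.
rewrite complex_probabilityE; last exact: (@bigcupT_measurable _ B F bF).
have cvgP : (fun n => \sum_(0 <= k < n) fine (P (F k))) @ \oo --> fine (P (\bigcup_n F n)).
  have PF : (fun n => \sum_(0 <= k < n) P (F k))%E @ \oo -->
      (fine (P (\bigcup_n F n)))%:E.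
    rewrite fineK; last exact: fin_num_measure (bigcupT_measurable _ bF).
    exact: (@measure_sigma_additive _ _ B P F bF tF).
  apply: cvg_trans (fine_cvg PF); apply: near_eq_cvg; apply: nearW => n /=.
  by rewrite sum_fine// => k _; apply: fin_num_measure; exact: bF.
apply/cvgrPdist_lt => e e0; have eE : e = (Re e)%:C by rewrite RRe_real// gtr0_real.
rewrite eE; have Re0 : 0 < Re e by rewrite -ltcR -eE.
move/cvgrPdist_lt : cvgP => /(_ _ Re0); apply: filterS => n.
rewrite (eq_bigr (fun k => (fine (P (F k)))%:C)); last first.
  by move=> k _; rewrite complex_probabilityE.
by rewrite -rmorph_sum -rmorphB normc_def/= expr0n/= addr0 sqrtr_sqr ltcR.
Qed.

Lemma upper_variation_Re A : borel A ->
  upper_variation (fun A => Re (complex_probability A)) A = P A.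
Proof.
move=> bA; apply/eqP; rewrite eq_le; apply/andP; split.
  apply: ge_ereal_sup => _ [C [bC CA] <-].
  rewrite complex_probabilityE//= fineK; last exact: fin_num_measure.
  by apply: le_measure => //; exact: mem_set.
apply: ereal_sup_ubound; exists A; first by split.
by rewrite complex_probabilityE//= fineK//; exact: fin_num_measure.
Qed.

Lemma upper_variation_le0 (nu : set T -> R) A : nu set0 = 0 ->
  (forall C, nu C <= 0) -> upper_variation nu A = 0%E.
Proof.
move=> nu0 nu_le0; apply/eqP; rewrite eq_le; apply/andP; split.
  by apply: ge_ereal_sup => _ [C _ <-]; rewrite lee_fin.
by apply: ereal_sup_ubound; exists set0; [split=> //; exact: (@measurable0 _ B)|rewrite nu0].
Qed.

Let Re0 A : 0 <= Re (complex_probability A).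
Proof.
by rewrite /complex_probability; case: asboolP => //= _; rewrite fine_ge0.
Qed.

Let Im0 A : Im (complex_probability A) = 0.
Proof. by rewrite /complex_probability; case: asboolP. Qed.

Lemma signed_integral_Re f :
  signed_integral (fun A => Re (complex_probability A)) f = \int[P]_x f x.
Proof.
rewrite /signed_integral (@eq_on_measurable_integral _ B R _ P); last first.
  by move=> A mA; exact: upper_variation_Re.
rewrite (@eq_on_measurable_integral _ B R (upper_variation (fun A => - _)) mzero); last first.
  move=> A _; rewrite /mzero; apply: upper_variation_le0 => [|C]; last by rewrite oppr_le0.
  by rewrite complex_probabilityE ?measure0 ?oppr0//; exact: (@measurable0 _ B).
by rewrite integral_measure_zero subr0.
Qed.

Lemma signed_integral_Im f :
  signed_integral (fun A => Im (complex_probability A)) f = 0.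
Proof.
rewrite (_ : (fun A => Im _) = (fun=> 0)); last by apply/funext => A; exact: Im0.
by rewrite /signed_integral oppr0 subrr.
Qed.

Lemma cintegral_probability f : cintegral complex_probability f =
  (\int[P]_x Re (f x)) +i* (\int[P]_x Im (f x)).
Proof.
by rewrite /cintegral !signed_integral_Re !signed_integral_Im subr0 addr0.
Qed.

Lemma continuous_borel_measurable (f : T -> R) :
  continuous f -> measurable_fun setT (f : B -> R).
Proof.
move=> cf; apply: (measurability _ (RGenOpens.measurableE R)).
move=> _ [_ [a [b ->]] <-]; rewrite setTI; apply: sub_sigma_algebra.
by move/continuousP : cf; apply; exact: interval_open.
Qed.

Lemma bounded_continuous_integrable (f : T -> R) M : continuous f ->
  (forall x, `|f x| <= M) -> P.-integrable setT (EFin \o f).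
Proof.
move=> cf fM; apply: measurable_bounded_integrable => //.
- by rewrite (le_lt_trans (probability_le1 P measurableT))// ltry.
- exact: continuous_borel_measurable.
- exists M; split; first exact: num_real.
  by move=> N MN x _ /=; exact: le_trans (fM x) (ltW MN).
Qed.

(** The set where [f] differs from [c] is open and avoids [C], which carries
    the whole mass of [P]. *)
Lemma Rintegral_const_on_support (f : T -> R) (c : R) (C : set T) : continuous f ->
  (forall A, C `&` A = set0 -> P A = 0%E) -> (forall x, C x -> f x = c) ->
  \int[P]_x f x = c.
Proof.
move=> cf PC fC; have mf := continuous_borel_measurable cf.
have E : \int[P]_x f x = \int[P]_(x in setT) c.
  rewrite /Rintegral; congr fine; apply: ae_eq_integral => //.
  - exact/measurable_EFinP.
  - exists (f @^-1` [set~ c]); split.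
    + by rewrite -[X in measurable X]setTI; apply: mf => //; exact: measurableC.
    + apply: PC; rewrite -subset0 => x [Cx]; apply; exact: fC.
    + by move=> x /= h fx; apply: h => _; rewrite fx.
by rewrite E Rintegral_cst//= probability_setT mulr1.
Qed.

End ProbabilityAsComplexMeasure.

(** * Real inner product, Riesz representation and isometric relations *)

Lemma discriminant_le0 (R : realFieldType) (a b c : R) : 0 <= a ->
  (forall t, 0 <= a * t ^+ 2 + 2 * b * t + c) -> b ^+ 2 <= a * c.
Proof.
move=> a0 h; have [az|an0] := eqVneq a 0; first rewrite az in h *.
  have [->|b0] := eqVneq b 0; first by rewrite expr0n/= mul0r.
  have := h (- (c + 1) / (2 * b)); rewrite (_ : 2 * b * _ = - (c + 1)); last by field.
  rewrite mul0r add0r; lra.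
have ap : 0 < a by rewrite lt_neqAle eq_sym an0.
have := h (- b / a); rewrite (_ : _ + c = (a * c - b ^+ 2) / a); last by field.
by rewrite pmulr_lge0 ?invr_gt0// subr_ge0.
Qed.

Section RealInnerProduct.
Context {R : realType} {H : hilbertType R}.
Local Notation Re := (@complex.Re R).
Local Notation Im := (@complex.Im R).
Implicit Types x y z : H.

Definition rdot x y : R := Re (dotp x y).
Definition hnorm x : R := Re `|x|.

Lemma dotpC x y : dotp x y = (dotp y x)^*.
Proof. by rewrite hermC expr0 mul1r. Qed.

Lemma rdotC x y : rdot x y = rdot y x.
Proof. by rewrite /rdot dotpC; case: (dotp y x). Qed.

Lemma rdotDl x y z : rdot (x + y) z = rdot x z + rdot y z.
Proof. by rewrite /rdot linearDl raddfD. Qed.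

Lemma rdotZl (r : R) x y : rdot (r%:C *: x) y = r * rdot x y.
Proof. by rewrite /rdot linearZl_LR /=; case: (dotp x y) => a b /=; rewrite mul0r subr0. Qed.

Lemma rdotNl x y : rdot (- x) y = - rdot x y.
Proof. by rewrite /rdot linearNl raddfN. Qed.

Lemma rdotDr x y z : rdot z (x + y) = rdot z x + rdot z y.
Proof. by rewrite !(rdotC z) rdotDl. Qed.

Lemma rdotZr (r : R) x y : rdot y (r%:C *: x) = r * rdot y x.
Proof. by rewrite !(rdotC y) rdotZl. Qed.

Lemma rdotNr x y : rdot y (- x) = - rdot y x.
Proof. by rewrite !(rdotC y) rdotNl. Qed.

Lemma Im_dotp x y : Im (dotp x y) = rdot x ('i *: y).
Proof.
rewrite /rdot [dotp x (_ *: _)]dotpC linearZl_LR/= [dotp x y]dotpC; case: (dotp y x) => a b /=.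
by rewrite !mul0r mul1r sub0r.
Qed.

Lemma normE x : `|x| = (hnorm x)%:C.
Proof. by rewrite RRe_real// ger0_real. Qed.

Lemma hnorm_sqr x : hnorm x ^+ 2 = rdot x x.
Proof. by have := dotp_norm x; rewrite normE -rmorphXn/= /rdot => <-. Qed.

Lemma hnorm_ge0 x : 0 <= hnorm x.
Proof. by rewrite -lecR -normE normr_ge0. Qed.

Lemma hnormD x y : hnorm (x + y) <= hnorm x + hnorm y.
Proof. by rewrite -lecR rmorphD/= -!normE ler_normD. Qed.

Lemma hnormZ (c : R[i]) x : hnorm (c *: x) = Re `|c| * hnorm x.
Proof.
by apply: complexI; rewrite rmorphM/= -!normE normrZ; congr (_ * _).
Qed.

Lemma hnormN x : hnorm (- x) = hnorm x.
Proof. by rewrite /hnorm normrN. Qed.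

Lemma hnormB x y : hnorm (x - y) = hnorm (y - x).
Proof. by rewrite -hnormN opprB. Qed.

Lemma hnorm0_eq0 x : hnorm x = 0 -> x = 0.
Proof. by move=> x0; apply/eqP; rewrite -normr_eq0 normE x0. Qed.

Lemma rdot_expand x y (t : R) :
  rdot (x + t%:C *: y) (x + t%:C *: y) = rdot y y * t ^+ 2 + 2 * rdot x y * t + rdot x x.
Proof. rewrite rdotDl !rdotDr !rdotZl !rdotZr (rdotC y x); ring. Qed.

Lemma rdot_ge0 x : 0 <= rdot x x.
Proof. by rewrite -hnorm_sqr sqr_ge0. Qed.

Lemma rdot_CauchySchwarz x y : `|rdot x y| <= hnorm x * hnorm y.
Proof.
rewrite -(@ler_pXn2r _ 2)// ?nnegrE ?mulr_ge0 ?hnorm_ge0//.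
rewrite real_normK ?num_real// exprMn !hnorm_sqr mulrC.
apply: discriminant_le0 => [|t]; first exact: rdot_ge0.
by rewrite -rdot_expand rdot_ge0.
Qed.

Lemma hilbert_complete (u : nat -> H) :
    (forall e, 0 < e -> exists N, forall m n, (N <= m)%N -> (N <= n)%N ->
       hnorm (u m - u n) < e) ->
  exists z, forall e, 0 < e -> exists N, forall n, (N <= n)%N -> hnorm (z - u n) < e.
Proof.
move=> uC; have /cvg_ex[z uz] : cvg (u @ \oo).
  apply: cauchy_cvg; apply/cauchyP => e e0.
  have eE : e = (Re e)%:C by rewrite RRe_real// gtr0_real.
  have Re0 : 0 < Re e by rewrite -ltcR -eE.
  have [N uN] := uC _ Re0; exists (u N); exists N => // n /= Nn.
  by rewrite -ball_normE /= normE eE ltcR; exact: uN.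
exists z => e e0; have e0C : 0 < e%:C by rewrite ltcR.
move/cvgrPdist_lt : uz => /(_ _ e0C)[N _ uN]; exists N => n Nn.
by have := uN n Nn; rewrite /= normE ltcR.
Qed.

Lemma hnorm_dense (S : set H) x (e : R) : dense S -> 0 < e ->
  exists2 p, S p & hnorm (x - p) < e.
Proof.
move=> dS e0; have e0C : 0 < e%:C by rewrite ltcR.
have [p [xp Sp]] : ball x e%:C `&` S !=set0.
  by apply: dS; [exists x; exact: ballxx|exact: ball_open].
by exists p => //; move: xp; rewrite -ball_normE /= normE ltcR.
Qed.

(** Riesz representation by Dirichlet's principle: [z] is the limit of a
    minimising sequence of [y |-> |y|^2 - 2 l y], Cauchy by the parallelogram
    law. The bound on [l] is boundedness in the form that the functional
    needs. *)
Lemma riesz_representation (l : H -> R) (C : R) :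
    (forall x y, l (x + y) = l x + l y) ->
    (forall (r : R) x, l (r%:C *: x) = r * l x) ->
    (forall y, 2 * l y <= C + rdot y y) ->
  exists z, forall y, rdot z y = l y.
Proof.
move=> lD lZ lC; pose J y := rdot y y - 2 * l y.
pose d := inf (range J).
have lbJ : has_inf (range J).
  split; first by exists (J 0), 0.
  by exists (- C) => _ [y _ <-]; rewrite /J; have := lC y; lra.
have dJ y : d <= J y by apply: ge_inf; [exact: lbJ.2|exists y].
have /choice[u uP] (n : nat) : exists y, J y < d + n.+1%:R^-1.
  have n0 : 0 < n.+1%:R^-1 :> R by rewrite invr_gt0.
  by have [_ [y _ <-] Jy] := inf_adherent n0 lbJ; exists y.
(* the parallelogram law at the midpoint of [x] and [y] *)
have para x y : rdot (x - y) (x - y) <= 2 * (J x - d) + 2 * (J y - d).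
  have := dJ ((2^-1)%:C *: (x + y)).
  rewrite /J rdotZl rdotZr lZ lD !(rdotDl, rdotDr, rdotNl, rdotNr) (rdotC y x); lra.
have [z uz] : exists z, forall e, 0 < e ->
    exists N, forall n, (N <= n)%N -> hnorm (z - u n) < e.
  apply: hilbert_complete => e e0; have e20 : 0 < e ^+ 2 / 4 by rewrite divr_gt0 ?exprn_gt0.
  have [N _ hN] := near_infty_natSinv_lt (PosNum e20).
  exists N => m n Nm Nn; rewrite -(@ltr_pXn2r _ 2)// ?nnegrE ?hnorm_ge0 ?(ltW e0)//.
  rewrite hnorm_sqr; apply: le_lt_trans (para _ _) _.
  have := hN m Nm; have := hN n Nn; have := uP m; have := uP n; rewrite /=.
  by move: (n.+1%:R^-1) (m.+1%:R^-1) => *; lra.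
(* [u n + t y] cannot improve on the infimum [d], and [u n] is within
   [1/(n+1)] of it: a quadratic polynomial in [t] is nonnegative *)
have approx n y : (rdot (u n) y - l y) ^+ 2 <= rdot y y * n.+1%:R^-1.
  apply: discriminant_le0 => [|t]; first exact: rdot_ge0.
  have := dJ (u n + t%:C *: y); have := uP n.
  rewrite /J rdot_expand lD lZ; move: (n.+1%:R^-1) => *; lra.
exists z => y; apply/eqP; rewrite -subr_eq0 -normr_le0; apply/ler_addgt0Pr => e e0.
rewrite add0r; pose k := hnorm y + 1.
have k0 : 0 < k by rewrite ltr_wpDl ?hnorm_ge0.
have ek0 : 0 < e / (2 * k) by rewrite divr_gt0 ?mulr_gt0.
have [N uN] := uz _ ek0.
have ek20 : 0 < (e / (2 * k)) ^+ 2 by rewrite exprn_gt0.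
have [M _ hM] := near_infty_natSinv_lt (PosNum ek20).
pose n := maxn N M.
have zn : `|rdot (z - u n) y| <= e / 2.
  apply: (le_trans (rdot_CauchySchwarz _ _)).
  apply: (@le_trans _ _ (e / (2 * k) * k)); last first.
    by rewrite le_eqVlt; apply/orP; left; apply/eqP; field; rewrite gt_eqF.
  apply: ler_pM; rewrite ?hnorm_ge0//; last by rewrite lerDl.
  by apply/ltW/uN; rewrite leq_maxl.
have ln : `|rdot (u n) y - l y| <= e / 2.
  rewrite -(@ler_pXn2r _ 2)// ?nnegrE ?divr_ge0 ?(ltW e0)// real_normK ?num_real//.
  apply: (le_trans (approx _ _)); rewrite -hnorm_sqr.
  apply: (@le_trans _ _ (k ^+ 2 * (e / (2 * k)) ^+ 2)).
    apply: ler_pM; rewrite ?sqr_ge0 ?invr_ge0//.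
      by rewrite ler_pXn2r// ?nnegrE ?hnorm_ge0 ?(ltW k0)// lerDl.
    by apply/ltW/(hM n); rewrite /= leq_maxr.
  by rewrite le_eqVlt; apply/orP; left; apply/eqP; field; rewrite gt_eqF.
rewrite (_ : _ - _ = rdot (z - u n) y + (rdot (u n) y - l y)).
  by apply: (le_trans (ler_normD _ _)); lra.
by rewrite rdotDl rdotNl; ring.
Qed.

End RealInnerProduct.

Lemma eps_bound_le0 (R : realFieldType) (x c : R) : 0 < c ->
  (forall e, 0 < e -> x <= c * e) -> x <= 0.
Proof.
move=> c0 h; apply/ler_addgt0Pr => e e0; rewrite add0r.
have := h (e / c) (divr_gt0 e0 c0); rewrite (_ : c * (e / c) = e)//.
by field; rewrite gt_eqF.
Qed.

Section RelationClosure.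
Context {R : realType} {H H' : hilbertType R}.

Definition approximable (G : H -> H' -> Prop) (a : H) (b : H') : Prop :=
  forall e, 0 < e -> exists p q, [/\ G p q, hnorm (a - p) < e & hnorm (b - q) < e].

Variable G : H -> H' -> Prop.
Hypothesis G_linear : forall (c : R[i]) a b a' b',
  G a b -> G a' b' -> G (c *: a + a') (c *: b + b').
Hypothesis G_hnorm : forall a b, G a b -> hnorm a = hnorm b.

Lemma approximable_linear (c : R[i]) a b a' b' :
  approximable G a b -> approximable G a' b' ->
  approximable G (c *: a + a') (c *: b + b').
Proof.
move=> ab ab' e e0; pose k := complex.Re `|c| + 1.
have k_ge : complex.Re `|c| <= k by rewrite lerDl.
have c0 : 0 <= complex.Re `|c| by rewrite -ler0c RRe_real// ger0_real.
have k0 : 0 < k by rewrite ltr_wpDl.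
have d0 : 0 < e / (2 * k) by rewrite divr_gt0 ?mulr_gt0.
have e20 : 0 < e / 2 by rewrite divr_gt0.
have [p [q [pq ap bq]]] := ab _ d0; have [p' [q' [pq' ap' bq']]] := ab' _ e20.
exists (c *: p + p'), (c *: q + q'); split; first exact: G_linear.
- rewrite opprD addrACA -scalerBr; apply: (le_lt_trans (hnormD _ _)).
  rewrite [e]splitr ler_ltD// hnormZ; apply: (@le_trans _ _ (k * (e / (2 * k)))).
    by apply: ler_pM => //; [exact: hnorm_ge0|exact: ltW].
  by rewrite le_eqVlt; apply/orP; left; apply/eqP; field; rewrite gt_eqF.
- rewrite opprD addrACA -scalerBr; apply: (le_lt_trans (hnormD _ _)).
  rewrite [e]splitr ler_ltD// hnormZ; apply: (@le_trans _ _ (k * (e / (2 * k)))).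
    by apply: ler_pM => //; [exact: hnorm_ge0|exact: ltW].
  by rewrite le_eqVlt; apply/orP; left; apply/eqP; field; rewrite gt_eqF.
Qed.

Lemma approximable_hnorm a b : approximable G a b -> hnorm a = hnorm b.
Proof.
move=> ab; apply/eqP; rewrite -subr_eq0 -normr_le0; apply: (@eps_bound_le0 _ _ 2) => // e e0.
have [p [q [/G_hnorm pq ap bq]]] := ab _ e0.
have := hnormD (a - p) p; have := hnormD (p - a) a; rewrite !subrK (hnormB p).
have := hnormD (b - q) q; have := hnormD (q - b) b; rewrite !subrK (hnormB q).
by move=> *; rewrite ler_norml; apply/andP; split; lra.
Qed.

(** Approximations [p n] of [a] in the domain form a Cauchy sequence, hence so
    do their partners [q n], since the relation is linear and isometric. *)
Lemma approximable_total : dense [set a | exists b, G a b] ->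
  forall a, exists b, approximable G a b.
Proof.
move=> dG a.
have /choice[p pP] (n : nat) : exists p, (exists b, G p b) /\ hnorm (a - p) < n.+1%:R^-1.
  have n0 : 0 < n.+1%:R^-1 :> R by rewrite invr_gt0.
  by have [p] := hnorm_dense a dG n0; exists p.
have /choice[q qP] n : exists b, G (p n) b by have [] := pP n.
have ap (e : R) : 0 < e -> exists N, forall n, (N <= n)%N -> hnorm (a - p n) < e.
  move=> e0; have [N _ hN] := near_infty_natSinv_lt (PosNum e0).
  by exists N => n Nn; apply: lt_trans (pP n).2 (hN n Nn).
have [|b qb] := @hilbert_complete _ _ q.
  move=> e e0; have e20 : 0 < e / 2 by rewrite divr_gt0.
  have [N hN] := ap _ e20; exists N => m n Nm Nn.
  rewrite addrC -scaleN1r -(G_hnorm (G_linear (-1) (qP n) (qP m))) scaleN1r addrC.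
  rewrite -(subrKA a); apply: (le_lt_trans (hnormD _ _)); rewrite hnormB [e]splitr.
  by rewrite ltrD// hN.
exists b => e e0; have [N hN] := ap _ e0; have [M hM] := qb _ e0.
exists (p (maxn N M)), (q (maxn N M)); split => //.
- by apply: hN; rewrite leq_maxl.
- by apply: hM; rewrite leq_maxr.
Qed.

End RelationClosure.

(** The closure of a densely defined isometric linear relation with dense range
    is the graph of a unitary map. *)
Lemma unitary_of_dense_isometry (R : realType) (H H' : hilbertType R)
    (G : H -> H' -> Prop) :
    (forall (c : R[i]) a b a' b', G a b -> G a' b' -> G (c *: a + a') (c *: b + b')) ->
    (forall a b, G a b -> hnorm a = hnorm b) ->
    dense [set a | exists b, G a b] -> dense [set b | exists a, G a b] ->
  exists U : {linear H -> H'},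
    [/\ forall x y, dotp (U x) (U y) = dotp x y, range U = setT
      & forall a b, G a b -> U a = b].
Proof.
move=> Glin Gnorm domG ranG.
have /choice[f fP] := approximable_total Glin Gnorm domG.
have f_uniq a b : approximable G a b -> f a = b.
  move=> ab; have := approximable_linear Glin (-1) (fP a) ab.
  rewrite !scaleN1r addNr => /(approximable_hnorm Gnorm).
  move=> h0; apply/esym/eqP; rewrite -subr_eq0 addrC; apply/eqP/hnorm0_eq0.
  by rewrite -h0 /hnorm normr0.
have f_lin : linear f.
  by move=> c x y; apply: f_uniq; exact: approximable_linear.
pose U : {linear H -> H'} := HB.pack f (GRing.isLinear.Build _ _ _ _ f f_lin).
have UE x : U x = f x by [].
have Unorm x : rdot (U x) (U x) = rdot x x.
  by rewrite -!hnorm_sqr UE -(approximable_hnorm Gnorm (fP x)).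
have Urdot x y : rdot (U x) (U y) = rdot x y.
  have := Unorm (x + y); rewrite linearD !(rdotDl, rdotDr) !Unorm (rdotC (U y)) (rdotC y); lra.
exists U; split.
- move=> x y.
  have Redotp : complex.Re (dotp (U x) (U y)) = complex.Re (dotp x y) by exact: Urdot.
  have : complex.Im (dotp (U x) (U y)) = complex.Im (dotp x y).
    by rewrite !Im_dotp -Urdot linearZ.
  by move: Redotp; case: (dotp (U x) _) => ? ?; case: (dotp x y) => ? ? /= -> ->.
- rewrite -subTset => b _; have [a ba] : exists a, approximable (fun b a => G a b) b a.
    apply: (approximable_total _ _ ranG) => [c ? ? ? ?|? ? /Gnorm //]; exact: Glin.
  exists a => //; apply: f_uniq => e e0; have [q [p [? ? ?]]] := ba e e0.
  by exists p, q.
- move=> a b ab; apply: f_uniq => e e0; exists a, b.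
  by rewrite !subrr /hnorm !normr0.
Qed.

(** * Matrix coefficients and the biinvariant measure *)

Lemma borel_preimage (S T : ptopologicalType) (h : S -> T) (A : set T) :
  continuous h -> borel A -> borel (h @^-1` A).
Proof.
move=> /continuousP ch bA; rewrite -[_ @^-1` _]setTI.
suff mh : measurable_fun setT
    (h : g_sigma_algebraType (@open S) -> g_sigma_algebraType (@open T)) by exact: mh.
apply: (@measurability _ _ (g_sigma_algebraType (@open S)) (g_sigma_algebraType (@open T))
  setT h (@open T)) => // _ [U oU <-].
by rewrite setTI; apply: sub_sigma_algebra; exact: ch.
Qed.

(** The measure is built inside one of the groups of the limit and pushed
    forward to [G]. *)
Lemma biinvariant_probability (R : realType) (G : preTopologicalGroupType)
    (L : polish_direct_limit R G) (K : set G) (g : G) :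
    is_subgroup K -> compact K ->
  exists (P : probability (g_sigma_algebraType (@open G)) R) (C : set G),
    [/\ forall A, C `&` A = set0 -> P A = 0%E,
        forall x, C x -> exists a b, [/\ K a, K b & x = (a * g * b)%g]
      & biinvariant_algebra K (complex_probability P)].
Proof.
move=> [K1 KM KV] cK.
have [n1 Kn1] := compact_sub_dl_group L cK.
have [n2 _ [g2 _ g2E]] : (\bigcup_n range (@dl_emb R G L n)) g by rewrite dl_cover.
have [j1 j1E _] := dl_emb_le L (leq_maxl n1 n2).
have [j2 j2E _] := dl_emb_le L (leq_maxr n1 n2).
pose n := maxn n1 n2; pose emb : dl_group L n -> G := @dl_emb R G L n.
have Kn : K `<=` range emb.
  by move=> k /Kn1[x _ <-]; exists (j1 x) => //; exact: j1E.
have gE : emb (j2 g2) = g by rewrite /emb j2E.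
have cK' : compact (emb @^-1` K) by exact: dl_emb_preimage_compact.
have subK' : is_subgroup (emb @^-1` K).
  split=> [|x y Kx Ky|x Kx] /=; rewrite /emb.
  - by rewrite dl_emb1.
  - by rewrite dl_embM; exact: KM.
  - by rewrite dl_embV; exact: KV.
have emb_cont : continuous emb := @dl_emb_continuous R G L n.
have [_ [M [f [h [fK _ cf ch _]]]]] := dl_polish L n.
have [P [P0 PKl PKr]] := double_coset_measure fK cf ch subK' cK' (j2 g2) emb_cont.
exists P, (emb @` double_coset (emb @^-1` K) (j2 g2)); split=> //.
  move=> _ [_ [[a b] [/= Ka Kb] <-] <-]; exists (emb a), (emb b).
  by split; rewrite // /emb !dl_embM -/emb gE.
(* Since [complex_probability] vanishes off the Borel sets, invariance needs
   translations to preserve non-Borel sets as well, hence the inverse [t']. *)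
have trans (t t' : G -> G) A : cancel t' t -> continuous t -> continuous t' ->
    P (t @^-1` A) = P A -> complex_probability P (t @^-1` A) = complex_probability P A.
  move=> tK ct ct' PA; rewrite /complex_probability PA.
  rewrite (_ : `[< borel (t @^-1` A) >] = `[< borel A >])//.
  apply/asbool_equiv_eq; split=> [/(borel_preimage ct')|]; last exact: borel_preimage.
  by congr borel; apply/funext => x /=; rewrite tK.
split; first split.
- exact: complex_probability_measure.
- exists (emb @` double_coset (emb @^-1` K) (j2 g2)).
    apply: continuous_compact; last exact: double_coset_compact.
    exact: continuous_subspaceT.
  by move=> A bA; rewrite complex_probabilityE// setIC => /P0 ->.
- move=> k Kk A; have [k' _ kE] := Kn k Kk; split.
    apply: (trans _ (fun x => k^-1 * x)%g).
    + by move=> x; rewrite mulVKg.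
    + exact: (dl_mulg_continuous L).
    + exact: (dl_mulg_continuous L).
    + by apply: (PKl k') => [|x]; rewrite /= /emb ?dl_embM -/emb kE.
  apply: (trans _ (fun x => x * k^-1)%g).
  + by move=> x; rewrite mulgVK.
  + exact: (dl_mulgr_continuous L).
  + exact: (dl_mulgr_continuous L).
  + by apply: (PKr k') => [|x]; rewrite /= /emb ?dl_embM -/emb kE.
Qed.

Section MatrixCoefficients.
Context {R : realType} {G : preTopologicalGroupType} {H : hilbertType R}.
Variable rho : unitary_rep G H.

Lemma urep_hnorm g x : hnorm (rho g x) = hnorm x.
Proof.
apply/eqP; rewrite -(@eqrXn2 _ 2) ?hnorm_ge0// !hnorm_sqr.
by rewrite /rdot urep_dotp.
Qed.

Lemma urep_rdot_continuous x y : continuous (fun g => rdot (rho g x) y : R).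
Proof.
move=> g; apply/cvgrPdist_lt => e e0.
pose k := hnorm y + 1; have k0 : 0 < k by rewrite ltr_wpDl ?hnorm_ge0.
have ek0 : 0 < (e / k)%:C by rewrite ltcR divr_gt0.
have /cvgrPdist_lt/(_ _ ek0) := @urep_continuous _ _ _ rho x g.
apply: filterS => h /=; rewrite normE ltcR => hgh.
rewrite -rdotNl -rdotDl; apply: (le_lt_trans (rdot_CauchySchwarz _ _)).
apply: (@le_lt_trans _ _ (hnorm (rho g x - rho h x) * k)).
  by rewrite ler_wpM2l ?hnorm_ge0// lerDl.
by rewrite -ltr_pdivlMr.
Qed.

Lemma urep_rdot_bound x y g : `|rdot (rho g x) y| <= hnorm x * hnorm y.
Proof. by rewrite -(urep_hnorm g x); exact: rdot_CauchySchwarz. Qed.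

(** The real part of the weak integral is a bounded real linear functional of
    [y], represented by some [z]; the imaginary part follows by replacing [y]
    with ['i *: y].  Hence the choice in [measure_op] is among a nonempty set. *)
Lemma measure_opP (P : probability (g_sigma_algebraType (@open G)) R) x y :
  dotp (measure_op rho (complex_probability P) x) y =
  cintegral (complex_probability P) (fun g => dotp (rho g x) y).
Proof.
pose l y : R := \int[P]_g rdot (rho g x) y.
have int_rdot u : P.-integrable setT (EFin \o (fun g => rdot (rho g x) u)).
  apply: (@bounded_continuous_integrable _ _ P _ (hnorm x * hnorm u)).
    exact: urep_rdot_continuous.
  exact: urep_rdot_bound.
have lD u v : l (u + v) = l u + l v.
  by rewrite /l -RintegralD//; apply: eq_Rintegral => g _; rewrite rdotDr.
have lZ (r : R) u : l (r%:C *: u) = r * l u.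
  by rewrite /l -RintegralZl//; apply: eq_Rintegral => g _; rewrite rdotZr.
have lC u : 2 * l u <= hnorm x ^+ 2 + rdot u u.
  have : l u <= hnorm x * hnorm u.
    rewrite -[leRHS]mulr1 -[in leRHS](_ : fine (P setT) = 1); last by rewrite probability_setT.
    rewrite -Rintegral_cst//; apply: le_Rintegral => //.
      apply: (@bounded_continuous_integrable _ _ _ _ `|hnorm x * hnorm u|) => // z.
      exact: cvg_cst.
    by move=> g _; apply: le_trans (ler_norm _) (urep_rdot_bound _ _ _).
  rewrite -hnorm_sqr; have := sqr_ge0 (hnorm x - hnorm u); rewrite sqrrB; lra.
have [z zP] := riesz_representation lD lZ lC.
have zE u : dotp z u = cintegral (complex_probability P) (fun g => dotp (rho g x) u).
  have ReE : complex.Re (dotp z u) = \int[P]_g complex.Re (dotp (rho g x) u) := zP u.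
  have ImE : complex.Im (dotp z u) = \int[P]_g complex.Im (dotp (rho g x) u).
    by rewrite Im_dotp zP; apply: eq_Rintegral => g _; rewrite Im_dotp.
  by rewrite cintegral_probability -ReE -ImE; case: (dotp z u).
have := xgetPex (0 : H) (ex_intro (fun z => forall y, dotp z y = cintegral _ _) z zE).
exact.
Qed.

(** Moving the outer factors of [a * g * b] to the vectors, which they fix, shows
    that the coefficient is constant on [C]. *)
Lemma measure_op_double_coset (K C : set G) (g : G) x y
    (P : probability (g_sigma_algebraType (@open G)) R) :
    (forall A, C `&` A = set0 -> P A = 0%E) ->
    (forall h, C h -> exists a b, [/\ K a, K b & h = (a * g * b)%g]) ->
    fixed_vectors rho K x -> fixed_vectors rho K y ->
  dotp (measure_op rho (complex_probability P) x) y = dotp (rho g x) y.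
Proof.
move=> PC CK Kx Ky; rewrite measure_opP cintegral_probability.
have const h : C h -> dotp (rho h x) y = dotp (rho g x) y.
  move=> /CK[a [b [Ka Kb ->]]]; rewrite !urepM Kx//.
  by rewrite -[in LHS](Ky a Ka) urep_dotp.
rewrite (@Rintegral_const_on_support _ _ P _ (complex.Re (dotp (rho g x) y)) C)//.
- rewrite (@Rintegral_const_on_support _ _ P _ (complex.Im (dotp (rho g x) y)) C)//.
  + by case: (dotp (rho g x) y).
  + under eq_fun do rewrite Im_dotp; exact: urep_rdot_continuous.
  + by move=> h /const ->.
- exact: urep_rdot_continuous.
- by move=> h /const ->.
Qed.

End MatrixCoefficients.

(** * Orbits of fixed vectors and the intertwiner *)

Lemma denseS (T : topologicalType) (A B : set T) : A `<=` B -> dense A -> dense B.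
Proof.
move=> AB dA O O0 oO; have [x [Ox Ax]] := dA O O0 oO.
by exists x; split=> //; exact: AB.
Qed.

Section Span.
Context {R : realType} {G : preTopologicalGroupType} {V H : hilbertType R}.
Variables (rho : unitary_rep G H) (U : {linear V -> H}).

(** Sequences rather than families indexed by ordinals, so that sums of
    combinations are concatenations. *)
Definition orbit_combination (s : seq (R[i] * G * V)) : H :=
  \sum_(t <- s) t.1.1 *: rho t.1.2 (U t.2).

Lemma orbit_combination_cat s t :
  orbit_combination (s ++ t) = orbit_combination s + orbit_combination t.
Proof. by rewrite /orbit_combination big_cat. Qed.

Lemma orbit_combination_scale c s :
  orbit_combination [seq (c * t.1.1, t.1.2, t.2) | t <- s] = c *: orbit_combination s.
Proof.
rewrite /orbit_combination big_map scaler_sumr; apply: eq_bigr => t _ /=.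
by rewrite scalerA.
Qed.

Lemma orbit_combination_act g s :
  orbit_combination [seq (t.1.1, (g * t.1.2)%g, t.2) | t <- s] = rho g (orbit_combination s).
Proof.
rewrite /orbit_combination big_map linear_sum; apply: eq_bigr => t _ /=.
by rewrite linearZ urepM.
Qed.

Lemma orbit_combination_dense (S : set H) : range U = S -> cyclic_set rho S ->
  dense [set a | exists s, a = orbit_combination s].
Proof.
move=> US; apply: denseS => _ [n [c [g [eta [Seta ->]]]]].
have /choice[v vE] i : exists v, U v = eta i.
  by have := Seta i; rewrite -US => -[v _ <-]; exists v.
exists [seq (c i, g i, v i) | i <- enum 'I_n].
by rewrite /orbit_combination big_map big_enum /=; apply: eq_bigr => i _; rewrite vE.
Qed.

(** Unitarity moves [rho b] to the left-hand side, so that only coefficients of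
    vectors in the range of [U] occur. *)
Lemma dotp_orbit_combination s t : dotp (orbit_combination s) (orbit_combination t) =
  \sum_(a <- s) \sum_(b <- t)
    a.1.1 * (b.1.1)^* * dotp (rho (b.1.2^-1 * a.1.2)%g (U a.2)) (U b.2).
Proof.
rewrite /orbit_combination linear_sumlz; apply: eq_bigr => a _.
rewrite linear_sumr; apply: eq_bigr => b _.
rewrite linearZl_LR linearZr_LR /= mulrA; congr (_ * _).
by rewrite -[RHS](urep_dotp rho b.1.2) -urepM mulVKg.
Qed.

End Span.

Theorem proposition2p1 (R : realType) (G : preTopologicalGroupType)
    (limG : polish_direct_limit R G)
    (K : set G) (subK : is_subgroup K) (cptK : compact K)
    (V : hilbertType R) (sepV : separable_space V) (tau : star_rep K V)
    (H : hilbertType R) (sepH : separable_space H) (rho : unitary_rep G H)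
    (H' : hilbertType R) (sepH' : separable_space H') (rho' : unitary_rep G H')
    (cyc : cyclic_set rho (fixed_vectors rho K))
    (cyc' : cyclic_set rho' (fixed_vectors rho' K))
    (tau_rho : equivalent_to_Res tau rho)
    (tau_rho' : equivalent_to_Res tau rho') :
  unitarily_equivalent rho rho'.
Proof.
have [U [Udot Uran Utau]] := tau_rho; have [U' [U'dot U'ran U'tau]] := tau_rho'.
(* Both coefficients equal [dotp (tau nu v) w], for [nu] the biinvariant
   probability on the double coset of [g]. *)
have coef g v w : dotp (rho g (U v)) (U w) = dotp (rho' g (U' v)) (U' w).
  have [P [C [PC CK nuP]]] := biinvariant_probability limG g subK cptK.
  have Ufix x : fixed_vectors rho K (U x) by rewrite -Uran; exists x.
  have U'fix x : fixed_vectors rho' K (U' x) by rewrite -U'ran; exists x.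
  rewrite -(measure_op_double_coset PC CK (Ufix v) (Ufix w)).
  rewrite -(measure_op_double_coset PC CK (U'fix v) (U'fix w)).
  by rewrite -Utau// -U'tau// Udot U'dot.
pose rel a b := exists2 s, a = orbit_combination rho U s & b = orbit_combination rho' U' s.
have [W [Wdot Wran Wrel]] : exists W : {linear H -> H'},
    [/\ forall x y, dotp (W x) (W y) = dotp x y, range W = setT
      & forall a b, rel a b -> W a = b].
  apply: unitary_of_dense_isometry.
  - move=> c _ _ _ _ [s -> ->] [t -> ->].
    exists ([seq (c * a.1.1, a.1.2, a.2) | a <- s] ++ t);
      by rewrite orbit_combination_cat orbit_combination_scale.
  - move=> _ _ [s -> ->]; apply/eqP; rewrite -(@eqrXn2 _ 2) ?hnorm_ge0// !hnorm_sqr.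
    rewrite /rdot !dotp_orbit_combination; apply/eqP; congr (complex.Re _).
    by apply: eq_bigr => a _; apply: eq_bigr => b _; rewrite coef.
  - by apply: denseS (orbit_combination_dense Uran cyc) => _ [s ->]; eexists; exists s.
  - by apply: denseS (orbit_combination_dense U'ran cyc') => _ [s ->]; eexists; exists s.
have Wnorm y : hnorm (W y) = hnorm y.
  by apply/eqP; rewrite -(@eqrXn2 _ 2) ?hnorm_ge0// !hnorm_sqr /rdot Wdot.
exists W; split=> // g x; apply/eqP; rewrite -subr_eq0; apply/eqP/hnorm0_eq0/eqP.
rewrite eq_le hnorm_ge0 andbT; apply: (@eps_bound_le0 _ _ 2) => // e e0.
have [_ [s ->] xs] := hnorm_dense x (orbit_combination_dense Uran cyc) e0.
(* [W] intertwines the actions on orbit combinations, which are dense. *)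
have Ws : W (rho g (orbit_combination rho U s)) = rho' g (W (orbit_combination rho U s)).
  rewrite -orbit_combination_act [in RHS](Wrel _ (orbit_combination rho' U' s)).
    by rewrite -orbit_combination_act; apply: Wrel; eexists.
  by exists s.
pose y := x - orbit_combination rho U s.
rewrite (_ : _ - _ = W (rho g y) - rho' g (W y)); last first.
  by rewrite /y !linearB/= Ws opprK [- _ + _]addrC addrA subrK.
apply: (le_trans (hnormD _ _)); rewrite hnormN !(Wnorm, urep_hnorm); rewrite /y; lra.
Qed.
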